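(* Let $(\bm{X}_i)_{i\in\mathbb{N}}$ be an IID sequence with the same distribution as $\bm{X}$, and let the hypotheses $(\mathscr{H}_k)_{k\in[m]}$, losses $\ell_k$, risks $R_{k,n}$ and $r_k$, optimal index $k^*$, penalties $P_{k,n}$ and estimator $$\hat{K}_n=\min\,\underset{k\in[m]}{\arg\min}\left\{\min_{\bm{\theta}_k\in\mathbb{T}_k}R_{k,n}(\bm{\theta}_k)+P_{k,n}\right\}$$ be as defined in the context. Assume that for each $k\in[m]$: (A1) $\mathbb{T}_k$ is compact and there exists $\bm{\tau}_k\in\mathbb{T}_k$ such that $\mathrm{E}\{\ell_k(\bm{X};\bm{\tau}_k)^2\}<\infty$. (A2) There exists a measurable function $\mathfrak{C}_k:\mathbb{X}\to\mathbb{R}_{\ge 0}$ such that $\mathrm{E}\{\mathfrak{C}_k(\bm{X})^2\}<\infty$ and $|\ell_k(\bm{x};\bm{\theta}_k)-\ell_k(\bm{x};\bm{\tau}_k)|\le\mathfrak{C}_k(\bm{x})\|\bm{\theta}_k-\bm{\tau}_k\|$ for every $\bm{\theta}_k,\bm{\tau}_k\in\mathbb{T}_k$ and almost every $\bm{x}\in\mathbb{X}$. (B1) $P_{k,n}>0$ for each $n\in\mathbb{N}$, and $P_{k,n}=o_{\mathrm{Pr}}(1)$ as $n\to\infty$ (i.e. $P_{k,n}\to 0$ in probability). (B2) If $k<l$ (with $l\in[m]$), then $\sqrt{n}\,\{P_{l,n}-P_{k,n}\}\to\infty$ in probability, as $n\to\infty$. Then $$\lim_{n\to\infty}\mathrm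{Pr}\left(\hat{K}_n=k^*\right)=1.$$
   Context: Let $(\Omega,\mathcal{F},\mathrm{Pr})$ be a probability space with expectation $\mathrm{E}$, and let $\bm{X}:\Omega\to\mathbb{X}\subset\mathbb{R}^d$ be a random variable with law $\mathrm{Pr}_{\bm{X}}$ on $(\mathbb{X},\mathcal{B}(\mathbb{X}))$, where $\mathcal{B}(\mathbb{X})$ is the Borel $\sigma$-algebra; ''almost every $\bm{x}\in\mathbb{X}$'' is with respect to $\mathrm{Pr}_{\bm{X}}$. For $n\in\mathbb{N}$ write $[n]=\{1,\dots,n\}$. Fix $m\in\mathbb{N}$. For each $k\in[m]$, a hypothesis is a set of functions $$\mathscr{H}_k=\{h_k(\cdot;\bm{\theta}_k):\mathbb{X}\to\mathbb{R},\ \bm{\theta}_k\in\mathbb{T}_k\},\qquad \mathbb{T}_k\subset\mathbb{R}^{q_k},\ q_k\in\mathbb{N}.$$ Let $\ell:\mathbb{R}\to\mathbb{R}$ be a loss function and write $\ell_k(\bm{x};\bm{\theta}_k)=\ell(h_k(\bm{x};\bm{\theta}_k))$; the map $\ell_k(\cdot;\bm{\theta}_k):\mathbb{X}\to\mathbb{R}$ is measurable for each $\bm{\theta}_k\in\mathbb{T}_k$. The empirical and expected risks are $$R_{k,n}(\bm{\theta}_k)=\frac1n\sum_{i=1}^n\ell_k(\bm{X}_i;\bm{\theta}_k),\qquad r_k(\bm{\theta}_k)=\mathrm{E}\{\ell_k(\bm{X};\bm{\theta}_k)\}.$$ The optimal hypothesis index is $$k^*=\min\,\underset{k\in[m]}{\arg\min}\left\{\min_{\bm{\theta}_k\in\mathbb{T}_k}r_k(\bm{\theta}_k)\right\},$$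 i.e. the smallest index among those minimising $\min_{\bm{\theta}_k\in\mathbb{T}_k}r_k(\bm{\theta}_k)$ over $k\in[m]$. The penalties $P_{k,n}:\Omega\to\mathbb{R}_{\ge0}$ ($k\in[m]$, $n\in\mathbb{N}$) are random variables, which may depend on the data and the hypothesis index. A sequence of random variables $Z_n\to\infty$ in probability if for every $M>0$, $\mathrm{Pr}(Z_n>M)\to1$. *)

(* Defs.v *)
From HB Require Import structures.
From mathcomp Require Import all_boot all_order all_algebra.
From mathcomp Require Import all_classical all_reals all_analysis.

Set Implicit Arguments.
Unset Strict Implicit.
Unset Printing Implicit Defensive.

Import Order.TTheory GRing.Theory Num.Theory.
Import numFieldNormedType.Exports.

Local Open Scope classical_set_scope.
Local Open Scope ring_scope.

(* A [measurableType] must be pointed, so the subspace type [A] is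
   paired with one of its points; nothing else depends on the choice of [a]. *)
Definition subspace_at (T : topologicalType) (A : set T) (a : A) : Type :=
  set_type A.

HB.instance Definition _ (T : topologicalType) (A : set T) (a : A) :=
  Choice.copy (subspace_at a) (set_type A).
HB.instance Definition _ (T : topologicalType) (A : set T) (a : A) :=
  isPointed.Build (subspace_at a) a.

Definition subspace_open (T : topologicalType) (A : set T) (a : A) :
    set (set (subspace_at a)) :=
  @open (set_type A).

Arguments subspace_open {T A} a _.

Notation borel_on a := (g_sigma_algebraType (subspace_open a)).

Definition euclidean_norm (R : realType) (q : nat) (v : 'rV[R]_q) : R :=
  Num.sqrt (\sum_(i < q) v 0 i ^+ 2).

(* The least element of [A]; it is the arbitrary value [t0] when [A] has none. *)
Definition minimum (disp : Order.disp_t) (T : porderType disp) (t0 : T)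
    (A : set T) : T :=
  xget t0 [set v | A v /\ lbound A v].

(* [min arg min_k (f k)], with indices numbered from 0 to m; the set of
   minimisers is never empty, so the default [ord0] is never returned. *)
Definition min_argmin (disp : Order.disp_t) (T : orderType disp) (m : nat)
    (f : 'I_m.+1 -> T) : 'I_m.+1 :=
  minimum ord0 [set k | forall j, (f k <= f j)%O].

Definition empirical_risk (R : realType) (Omega XX Theta : Type)
    (loss : XX -> Theta -> R) (Xs : nat -> Omega -> XX) (n : nat)
    (w : Omega) (theta : Theta) : R :=
  n%:R^-1 * \sum_(i < n) loss (Xs i w) theta.

(* Extended-real valued, so that no integrability is presupposed. *)
Definition expected_risk (R : realType) (dO : measure_display)
    (Omega : measurableType dO) (Pr : probability Omega R) (XX Theta : Type)
    (loss : XX -> Theta -> R) (X : Omega -> XX) (theta : Theta) : \bar R :=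
  'E_Pr[fun w => loss (X w) theta].

Definition optimal_index (R : realType) (dO : measure_display)
    (Omega : measurableType dO) (Pr : probability Omega R) (XX : Type)
    (m : nat) (Theta : 'I_m.+1 -> Type) (TT : forall k, set (Theta k))
    (loss : forall k, XX -> Theta k -> R) (X : Omega -> XX) : 'I_m.+1 :=
  min_argmin (fun k => minimum 0%E (expected_risk Pr (loss k) X @` TT k)).

Definition estimated_index (R : realType) (Omega XX : Type)
    (m : nat) (Theta : 'I_m.+1 -> Type) (TT : forall k, set (Theta k))
    (loss : forall k, XX -> Theta k -> R) (Xs : nat -> Omega -> XX)
    (pen : 'I_m.+1 -> nat -> Omega -> R) (n : nat) (w : Omega) : 'I_m.+1 :=
  min_argmin (fun k =>
    minimum 0 (empirical_risk (loss k) Xs n w @` TT k) + pen k n w).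

Section probability_notions.
Context (R : realType) (dO : measure_display) (Omega : measurableType dO)
  (Pr : probability Omega R).
Local Open Scope ereal_scope.

Definition independent_sequence (d : measure_display) (T : measurableType d)
    (Xs : nat -> {RV Pr >-> T}) : Prop :=
  forall (J : seq nat) (A : nat -> set T), uniq J ->
    (forall i, measurable (A i)) ->
    Pr (\bigcap_(i in [set` J]) (Xs i @^-1` A i)) =
    \prod_(i <- J) Pr (Xs i @^-1` A i).

Definition same_distribution (d : measure_display) (T : measurableType d)
    (X Y : {RV Pr >-> T}) : Prop :=
  forall A : set T, measurable A -> distribution Pr X A = distribution Pr Y A.

Definition cvg0_in_probability (Z : nat -> Omega -> R) : Prop :=
  forall e : R, (0 < e)%R ->
    Pr [set w | (e < `|Z n w|)%R] @[n --> \oo] --> 0.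

Definition cvg_pinfty_in_probability (Z : nat -> Omega -> R) : Prop :=
  forall M : R, (0 < M)%R -> Pr [set w | (M < Z n w)%R] @[n --> \oo] --> 1.

(* [Pr] is only specified on measurable sets.  The inner probability gives a
   meaning to every set; it agrees with [Pr] on measurable sets
   ([inner_probabilityE]) and with the completion of [Pr] on sets that are
   measurable up to a null set. *)
Definition inner_probability (A : set Omega) : \bar R :=
  ereal_sup [set Pr B | B in [set B | measurable B /\ B `<=` A]].

Lemma inner_probabilityE (A : set Omega) :
  measurable A -> inner_probability A = Pr A.
Proof.
move=> mA; apply/eqP; rewrite eq_le; apply/andP; split.
  apply: ge_ereal_sup => _ [B [mB BA] <-].
  by apply: le_measure; rewrite ?inE.
by apply: ereal_sup_ubound; exists A => //; split.
Qed.

End probability_notions.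

(* Main.v *)
Require Import Defs.
From mathcomp Require Import all_boot all_order all_algebra.
From mathcomp Require Import all_classical all_reals all_analysis.
From mathcomp Require Import measurable_realfun ring lra.

Set Implicit Arguments.
Unset Strict Implicit.
Unset Printing Implicit Defensive.

Import Order.TTheory GRing.Theory Num.Theory.
Import numFieldNormedType.Exports.

Local Open Scope classical_set_scope.
Local Open Scope ring_scope.

(** The estimator compares penalised minimal empirical risks.  The whole proof
    rests on one estimate: for each hypothesis the minimal empirical risk is
    within K / sqrt n of the minimal expected risk, outside an event of
    probability eps, where K depends on eps but not on n ([min_risk_rate]).
    Granting it, let k be an index other than the optimal one.
    - If its minimal expected risk is strictly larger, the gap is a constant,
      and eventually beats both the fluctuations of order 1 / sqrt n and the
      penalty of the optimal index, which tends to 0 in probability.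
    - If it ties with the optimal one, then k comes later, because the optimal
      index is the first minimiser; sqrt n times the difference of penalties
      tends to infinity in probability, so the penalties decide against k.
    Finitely many such comparisons hold simultaneously with probability close
    to 1, and then the estimated index is the optimal one.

    The estimate is a tightness statement for the empirical process
    n^(-1/2) sum_i (f (X_i, theta) - E f (X, theta)), uniformly in theta
    ([uniform_lower_bound], [uniform_bound]).  The loss is Lipschitz in theta
    with a random constant having only a second moment, so Chebyshev bounds on
    increments are too weak for a union bound over nets when the dimension is
    at least 2.  The remedy is to truncate: with an envelope H of finite second
    moment, all H (X_i) with i < n are at most B = M sqrt n with probability at
    least 1 - E H^2 / M^2, and discarding larger values moves each mean by at
    most E H^2 / B, which is of order n^(-1/2).  After truncation the summands
    are of size B, hence the exponential moment of the sum divided by B is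
    bounded uniformly in n, and increments over a distance delta have tails
    exp (1 - t) at level delta t B ([iid_sum_tail]).  Exponential tails beat the
    polynomial growth of the nets of a bounded subset of R^q ([finite_nets]), so
    chaining along dyadic nets gives a bound independent of n
    ([chaining_level]).  Independence enters through the product formula for
    expectations ([integral_prod_iid]), applied to the exponentials. *)

(** * Expectations of products of independent variables *)

Section product_of_expectations.
Local Open Scope ereal_scope.
Context {R : realType} {d1 d2} {Omega : measurableType d1}
  {T : measurableType d2} (P : {measure set Omega -> \bar R})
  (mu : {measure set T -> \bar R}).
Import HBNNSimple.

(** Both sides are additive and continuous along increasing sequences in [g],
    so it is enough that they agree on indicators.  Taking for [W] a function of
    variables independent of [X], this turns the product rule for events into a
    product rule for expectations. *)
Lemma integral_weighted_comp (W : Omega -> R) (X : {mfun Omega >-> T}) (c : R) :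
  measurable_fun setT W -> (forall w, 0 <= W w)%R -> (0 <= c)%R ->
  (forall A, measurable A ->
    \int[P]_w (W w * \1_A (X w))%:E = c%:E * mu A) ->
  forall g : T -> R, measurable_fun setT g -> (forall x, 0 <= g x)%R ->
    \int[P]_w (W w * g (X w))%:E = c%:E * \int[mu]_x (g x)%:E.
Proof.
move=> mW W0 c0 hA g mg g0.
have mX : measurable_fun setT X by [].
have mgE : measurable_fun [set: T] (fun x => (g x)%:E) by exact/measurable_EFinP.
pose s := nnsfun_approx measurableT mgE.
have simple n : \int[P]_w (W w * s n (X w))%:E = c%:E * \int[mu]_x (s n x)%:E.
  rewrite integralT_nnsfun sintegralE.
  transitivity (\int[P]_w \sum_(r \in range (s n))
      (r * (W w * \1_(s n @^-1` [set r]) (X w)))%:E).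
    apply: eq_integral => w _; rewrite (fimfunE (s n) (X w)) !fsbig_finite//=.
    rewrite big_distrr/= -sumEFin.
    by apply: eq_bigr => r _; rewrite mulrCA.
  rewrite ge0_integral_fsum//; last 2 first.
    move=> r; apply/measurable_EFinP; apply: measurable_funM => //.
    apply: measurable_funM => //; apply: measurableT_comp => //.
    move=> r w _; have [r0|r0] := ltP r 0%R.
      by rewrite preimage_nnfun0// indicE in_set0 !mulr0.
    by rewrite lee_fin !mulr_ge0.
  rewrite !fsbig_finite//= ge0_sume_distrr; last first.
    by move=> r _; exact: nnsfun_mulemu_ge0.
  apply: eq_bigr => r _.
  have [r0|r0] := ltP r 0%R.
    rewrite preimage_nnfun0// measure0 !mule0.
    under eq_integral do rewrite indicE in_set0 !mulr0.
    by rewrite integral0.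
  under eq_integral do rewrite EFinM.
  rewrite ge0_integralZl//; last 2 first.
  - apply/measurable_EFinP; apply: measurable_funM => //.
    by apply: measurableT_comp.
  - by move=> w _; rewrite lee_fin mulr_ge0.
  by rewrite hA// muleCA.
have nd x (m n : nat) : (m <= n)%N -> (s m x <= s n x)%R.
  by move=> mn; exact/lefP/nd_nnsfun_approx.
have cv x : (s n x)%:E @[n --> \oo] --> (g x)%:E.
  apply: (@cvg_nnsfun_approx _ _ _ _ measurableT _ mgE) => // y _.
  by rewrite lee_fin.
have cL : \int[P]_w (W w * s n (X w))%:E @[n --> \oo] -->
    \int[P]_w (W w * g (X w))%:E.
  rewrite (_ : (fun w => (W w * g (X w))%:E) =
     (fun w => limn (fun n => (W w * s n (X w))%:E))); last first.
    apply/funext => w; apply/esym/cvg_lim => //.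
    under eq_fun do rewrite EFinM.
    by rewrite EFinM; apply: cvgeZl.
  apply: cvg_monotone_convergence => //.
  - move=> n; apply/measurable_EFinP; apply: measurable_funM => //.
    by apply: measurableT_comp.
  - by move=> n w _; rewrite lee_fin mulr_ge0.
  - by move=> w _ m n mn; rewrite lee_fin ler_wpM2l// nd.
have cR : c%:E * \int[mu]_x (s n x)%:E @[n --> \oo] -->
    c%:E * \int[mu]_x (g x)%:E.
  apply: cvgeZl => //.
  rewrite (_ : (fun x => (g x)%:E) =
     (fun x => limn (fun n => (s n x)%:E))); last first.
    by apply/funext => x; apply/esym/cvg_lim.
  apply: cvg_monotone_convergence => //.
  - by move=> n; apply/measurable_EFinP.
  - by move=> n x _; rewrite lee_fin.
  - by move=> x _ m n mn; rewrite lee_fin nd.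
rewrite -(cvg_lim _ cL)// -(cvg_lim _ cR)//.
by congr (limn _); apply/funext => n; exact: simple.
Qed.

End product_of_expectations.

Section iid.
Context {R : realType} {dO d} {Omega : measurableType dO}
  {T : measurableType d} (Pr : probability Omega R) (mu : probability T R)
  (Xs : nat -> {RV Pr >-> T}).
Hypothesis Xs_indep : independent_sequence Xs.
Hypothesis Xs_law : forall i A, measurable A -> Pr (Xs i @^-1` A) = mu A.
Local Open Scope ereal_scope.

(** Independence speaks of events only; the indicators are converted into the
    function [g] one variable at a time, by induction on [k], the remaining
    indices [J] staying in the form of indicators. *)
Lemma integral_prod_indic (g : T -> R) (gamma : R) :
  measurable_fun setT g -> (forall x, 0 <= g x)%R ->
  \int[mu]_x (g x)%:E = gamma%:E ->
  forall (k : nat) (J : seq nat) (A : nat -> set T), uniq J ->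
    (forall i, measurable (A i)) -> (forall i, i \in J -> (k <= i)%N) ->
    \int[Pr]_w (\prod_(i < k) g (Xs i w) * \prod_(i <- J) \1_(A i) (Xs i w))%:E
    = (gamma ^+ k * \prod_(i <- J) fine (mu (A i)))%:E.
Proof.
move=> mg g0 hg; have gamma0 : (0 <= gamma)%R.
  by rewrite -lee_fin -hg integral_ge0// => x _; rewrite lee_fin.
elim=> [|k IH] J A uJ mA kJ.
  rewrite expr0 mul1r; under eq_integral do rewrite big_ord0 mul1r.
  transitivity (\int[Pr]_w (\1_(\bigcap_(i in [set` J]) Xs i @^-1` A i) w)%:E).
    apply: eq_integral => w _; congr EFin.
    rewrite bigcap_seq; elim: J {uJ kJ} => [|j J IHJ].
      by rewrite !big_nil indicE in_setT.
    rewrite !big_cons IHJ indicI /=.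
    by congr (_ * _)%R; rewrite !indicE.
  rewrite integral_indic ?setIT//; last first.
    by apply: bigcap_measurableType => i _; exact: measurable_funPTI.
  transitivity (\prod_(i <- J) Pr (Xs i @^-1` A i)); first exact: Xs_indep.
  rewrite -prodEFin; apply: eq_bigr => i _.
  by rewrite Xs_law// fineK// fin_num_measure.
under eq_integral => w _.
  rewrite big_ord_recr/= -mulrA [(g _ * _)%R]mulrC mulrA.
  over.
have mX i : measurable_fun setT (Xs i) by [].
rewrite (@integral_weighted_comp _ _ _ _ _ Pr mu _ (Xs k)
  (gamma ^+ k * \prod_(i <- J) fine (mu (A i)))%R) //.
- by rewrite hg -EFinM exprSr mulrAC.
- apply: measurable_funM.
    by apply: measurable_prod => i _; apply: measurableT_comp.
  by apply: measurable_prod => i _; apply: measurableT_comp.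
- by move=> w; rewrite mulr_ge0// prodr_ge0.
- by rewrite mulr_ge0 ?exprn_ge0// prodr_ge0// => i _; rewrite fine_ge0.
move=> B mB.
(* The induction hypothesis applies to the index set enlarged by k. *)
pose A' i := if i == k then B else A i.
have kJ' : k \notin J by apply/negP => /kJ; rewrite ltnn.
have eqJ (F : nat -> set T -> R) :
    (\prod_(i <- J) F i (A i) = \prod_(i <- J) F i (A' i))%R.
  rewrite !big_seq; apply: eq_bigr => i iJ; rewrite /A'; case: eqP => // ik.
  by move: kJ'; rewrite -ik iJ.
have := IH (k :: J) A'; rewrite /= kJ' uJ => /(_ isT) H.
transitivity (\int[Pr]_w (\prod_(i < k) g (Xs i w) *
    \prod_(i <- k :: J) \1_(A' i) (Xs i w))%:E).
  apply: eq_integral => w _; congr EFin.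
  rewrite big_cons (eqJ (fun i C => \1_C (Xs i w))) {2}/A' eqxx; ring.
rewrite H; first last.
- by move=> i; rewrite inE => /orP[/eqP->//|/kJ/ltnW].
- by move=> i; rewrite /A'; case: eqP.
rewrite big_cons (eqJ (fun i C => fine (mu C))) {1}/A' eqxx.
have muB : mu B = (fine (mu B))%:E by rewrite fineK// fin_num_measure.
rewrite [in RHS]muB -EFinM; congr EFin; ring.
Qed.

Lemma integral_prod_iid (g : T -> R) (gamma : R) (n : nat) :
  measurable_fun setT g -> (forall x, 0 <= g x)%R ->
  \int[mu]_x (g x)%:E = gamma%:E ->
  \int[Pr]_w (\prod_(i < n) g (Xs i w))%:E = (gamma ^+ n)%:E.
Proof.
move=> mg g0 hg.
have := @integral_prod_indic g gamma mg g0 hg n [::] (fun _ => setT) isT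
  (fun _ => measurableT).
rewrite big_nil mulr1 => <-//.
by apply: eq_integral => w _; rewrite big_nil mulr1.
Qed.

End iid.

(** * Exponential tails for sums of bounded independent variables *)

(** For x <= 1 the bound (1 - x / 2) ^ 2 <= exp (- x) can be inverted; the
    constant 2 is what makes the product of the two quadratics at least 1. *)
Lemma expR_le_quadratic {R : realType} (x : R) :
  x <= 1 -> expR x <= 1 + x + 2 * x ^+ 2.
Proof.
move=> x1.
have h : (1 - x / 2) ^+ 2 <= expR (- x).
  rewrite (_ : - x = - (x / 2) + - (x / 2)); last by field.
  rewrite expRD -expr2 lerXn2r ?nnegrE ?expR_ge0 ?expR_ge1Dx//. lra.
have p : 0 < 1 + x + 2 * x ^+ 2 by nra.
have q : 1 <= (1 - x / 2) ^+ 2 * (1 + x + 2 * x ^+ 2).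
  rewrite -subr_ge0.
  rewrite (_ : _ - _ = x ^+ 2 / 4 * ((1 - x) * (5 - 2 * x))); last by field.
  by apply: mulr_ge0; [rewrite divr_ge0// sqr_ge0|apply: mulr_ge0; lra].
rewrite -(ler_pM2l (expR_gt0 (- x))) [leLHS]mulrC expRxMexpNx_1.
by apply: (le_trans q); rewrite ler_wpM2r// ltW.
Qed.

Section dominated.
Context {R : realType} {d} {T : measurableType d} (mu : probability T R).

Lemma measurable_ltr_cst (g : T -> R) (c : R) :
  measurable_fun setT g -> measurable [set x | g x < c].
Proof.
move=> mg; rewrite (_ : [set _ | _] = g @^-1` `]-oo, c[).
  by rewrite -[X in measurable X]setTI; exact: mg.
by apply/seteqP; split => x /=; rewrite in_itv.
Qed.

Lemma measurable_gtr_cst (g : T -> R) (c : R) :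
  measurable_fun setT g -> measurable [set x | c < g x].
Proof.
move=> mg; rewrite (_ : [set _ | _] = g @^-1` `]c, +oo[).
  by rewrite -[X in measurable X]setTI; exact: mg.
by apply/seteqP; split => x /=; rewrite in_itv/= andbT.
Qed.

Lemma integrable_dominated (g H : T -> R) :
  measurable_fun setT g -> (forall x, `|g x| <= H x) ->
  mu.-integrable setT (EFin \o H) -> mu.-integrable setT (EFin \o g).
Proof.
move=> mg gH; apply: le_integrable => //; first exact/measurable_EFinP.
by move=> x _ /=; rewrite lee_fin (le_trans (gH x))// ler_norm.
Qed.

Lemma integrable_bounded (g : T -> R) (b : R) :
  measurable_fun setT g -> (forall x, `|g x| <= b) ->
  mu.-integrable setT (EFin \o g).
Proof.
move=> mg gb; apply: integrable_dominated mg gb _.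
exact: finite_measure_integrable_cst.
Qed.

Lemma integrable_of_sqr (g : T -> R) : measurable_fun setT g ->
  mu.-integrable setT (EFin \o (fun x => g x ^+ 2)) ->
  mu.-integrable setT (EFin \o g).
Proof.
move=> mg Ig2; have I1 := finite_measure_integrable_cst mu 1 measurableT.
apply: (@integrable_dominated g (fun x => 1 + g x ^+ 2) mg); last first.
  exact: (integrableD measurableT I1 Ig2).
move=> x.
have := sqr_ge0 (`|g x| - 1).
have : `|g x| ^+ 2 = g x ^+ 2 by rewrite real_normK ?num_real.
have := normr_ge0 (g x); nra.
Qed.

Lemma RintegralN (g : T -> R) : mu.-integrable setT (EFin \o g) ->
  \int[mu]_x (- g x) = - \int[mu]_x g x.
Proof.
move=> Ig; rewrite -[RHS]mulN1r -RintegralZl//.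
by apply: eq_Rintegral => x _; rewrite mulN1r.
Qed.

Lemma integral_Rintegral (g : T -> R) : mu.-integrable setT (EFin \o g) ->
  (\int[mu]_x (g x)%:E = (\int[mu]_x g x)%:E)%E.
Proof. by move=> ig; rewrite /Rintegral fineK//; exact: integrable_fin_num. Qed.

Lemma Rintegral_dist_le (f g h : T -> R) :
  measurable_fun setT f -> measurable_fun setT g ->
  mu.-integrable setT (EFin \o f) -> mu.-integrable setT (EFin \o h) ->
  (forall x, `|f x - g x| <= h x) ->
  `|\int[mu]_x f x - \int[mu]_x g x| <= \int[mu]_x h x.
Proof.
move=> mf mg If Ih fg.
have mfg : measurable_fun setT (fun x => f x - g x) by exact: measurable_funB.
have Ifg := integrable_dominated mfg fg Ih.
have Ig : mu.-integrable setT (EFin \o g).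
  have -> : g = (fun x => f x - (f x - g x)) by apply/funext => x; ring.
  exact: (integrableB measurableT If Ifg).
rewrite -RintegralB//; apply: (le_trans (le_normr_Rintegral measurableT Ifg)).
apply: le_Rintegral => //; exact: integrable_norm.
Qed.

Lemma second_moment_tail (H : T -> R) (B : R) :
  0 < B -> measurable_fun setT H -> (forall x, 0 <= H x) ->
  mu.-integrable setT (EFin \o (fun x => H x ^+ 2)) ->
  (mu [set x | (B < H x)%R] <= ((\int[mu]_x (H x ^+ 2))%R / B ^+ 2)%:E)%E.
Proof.
move=> B0 mH H0 IH2.
set A := [set x | _].
have mA : measurable A := measurable_gtr_cst B mH.
rewrite -[X in (mu X <= _)%E]setIT -integral_indic//.
rewrite -RintegralZr// -integral_Rintegral; last first.
  exact: (integrableZr measurableT _ IH2).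
apply: ge0_le_integral => //.
- exact/measurable_EFinP.
- by apply/measurable_EFinP/measurable_funM => //; exact: measurable_funX.
move=> x _; rewrite lee_fin indicE; case: (boolP (x \in A)) => [|_] /=.
  rewrite inE /A/= => BH.
  rewrite ler_pdivlMr ?exprn_gt0// mul1r lerXn2r ?nnegrE//; exact: ltW.
by rewrite divr_ge0 ?sqr_ge0.
Qed.

Lemma integral_expR_le (v : T -> R) :
  measurable_fun setT v -> (forall x, `|v x| <= 1) ->
  (\int[mu]_x (expR (v x))%:E <=
    (expR (\int[mu]_x v x + 2 * \int[mu]_x (v x ^+ 2)))%:E)%E.
Proof.
move=> mv v1.
have iv := integrable_bounded mv v1.
have mv2 : measurable_fun setT (fun x => v x ^+ 2) by exact: measurable_funX.
have iv2 : mu.-integrable setT (EFin \o (fun x => v x ^+ 2)).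
  apply: (@integrable_bounded _ 1) => // x.
  by rewrite normrX expr_le1.
have i2v2 : mu.-integrable setT (EFin \o (fun x => 2 * v x ^+ 2)).
  apply: (@integrable_bounded _ 2); first exact: measurable_funM.
  by move=> x; rewrite normrM normrX (@ger0_norm _ 2)// ler_piMr// expr_le1.
have i1v : mu.-integrable setT (EFin \o (fun x => 1 + v x)).
  apply: (@integrable_bounded _ 2).
    exact: measurable_funD.
  by move=> x; rewrite (le_trans (ler_normD _ _))// normr1 -[2]/(1 + 1) lerD2l.
have iq : mu.-integrable setT (EFin \o (fun x => 1 + v x + 2 * v x ^+ 2)).
  exact: (integrableD measurableT i1v i2v2).
have mexp : measurable_fun setT (fun x => expR (v x)).
  exact: measurableT_comp.
apply: (@le_trans _ _ (\int[mu]_x (1 + v x + 2 * v x ^+ 2)%:E)%E).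
  apply: ge0_le_integral => //.
  - exact/measurable_EFinP.
  - exact: (measurable_int mu).
  - move=> x _; rewrite lee_fin expR_le_quadratic//.
    by have := v1 x; rewrite ler_norml => /andP[].
rewrite integral_Rintegral// lee_fin.
rewrite RintegralD// RintegralD//; last exact: finite_measure_integrable_cst.
rewrite Rintegral_cst//= probability_setT mulr1 RintegralZl//.
by rewrite -addrA expR_ge1Dx.
Qed.

End dominated.

Section tail.
Context {R : realType} {dO d} {Omega : measurableType dO}
  {T : measurableType d} (Pr : probability Omega R) (mu : probability T R)
  (Xs : nat -> {RV Pr >-> T}).
Hypothesis Xs_indep : independent_sequence Xs.
Hypothesis Xs_law : forall i A, measurable A -> Pr (Xs i @^-1` A) = mu A.

(** Markov's inequality for the exponential of the centred sum divided by [B].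
    The second-order term of its moment is at most 2 n E u^2 / B^2, and the
    hypothesis bounds it by 1: this is the 1 in the exponent 1 - t, and the
    reason why the bound does not depend on [n]. *)
Lemma iid_sum_tail (u : T -> R) (n : nat) (B t : R) :
  0 < B -> measurable_fun setT u -> (forall x, `|u x| <= B) ->
  2 * n%:R * \int[mu]_x (u x ^+ 2) <= B ^+ 2 ->
  (Pr [set w | (t * B < \sum_(i < n) u (Xs i w) - n%:R * \int[mu]_x u x)%R]
    <= (expR (1 - t))%:E)%E.
Proof.
move=> B0 mu_ uB hB.
pose v x := u x / B.
have mv : measurable_fun setT v by apply: measurable_funM.
have v1 x : `|v x| <= 1.
  by rewrite normrM normfV (gtr0_norm B0) ler_pdivrMr// mul1r.
have iu := integrable_bounded mu mu_ uB.
have va : \int[mu]_x v x = (\int[mu]_x u x) / B by rewrite RintegralZr.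
have iu2 : mu.-integrable setT (EFin \o (fun x => u x ^+ 2)).
  apply: (@integrable_bounded _ _ _ mu _ (B ^+ 2)).
    exact: measurable_funX.
  by move=> x; rewrite normrX lerXn2r ?nnegrE// ltW.
have vb : \int[mu]_x (v x ^+ 2) = (\int[mu]_x (u x ^+ 2)) / B ^+ 2.
  by rewrite -RintegralZr//; apply: eq_Rintegral => x _; rewrite expr_div_n.
set a := \int[mu]_x u x in hB va *; set b := \int[mu]_x (u x ^+ 2) in hB vb *.
have mexp : measurable_fun setT (fun x => expR (v x)) by exact: measurableT_comp.
have hle := integral_expR_le mu mv v1.
have hfin : (\int[mu]_x (expR (v x))%:E)%E \is a fin_num.
  rewrite ge0_fin_numE; first by rewrite (le_lt_trans hle)// ltry.
  by apply: integral_ge0 => x _; rewrite lee_fin expR_ge0.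
pose gamma := fine (\int[mu]_x (expR (v x))%:E)%E.
have hgamma : (\int[mu]_x (expR (v x))%:E)%E = gamma%:E by rewrite fineK.
have hprod := integral_prod_iid Xs_indep Xs_law n mexp (fun x => expR_ge0 (v x)) hgamma.
have gamma_le : gamma <= expR (a / B + 2 * (b / B ^+ 2)).
  by rewrite -lee_fin -hgamma -va -vb.
have gamma0 : 0 <= gamma.
  by rewrite -lee_fin -hgamma integral_ge0// => x _; rewrite lee_fin expR_ge0.
pose c := expR (- t - n%:R * (a / B)).
have mprod : measurable_fun setT (fun w => \prod_(i < n) expR (v (Xs i w))).
  by apply: measurable_prod => i _; apply: (measurableT_comp mexp).
have msum : measurable_fun setT (fun w => \sum_(i < n) u (Xs i w) - n%:R * a).
  apply: measurable_funB => //.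
  by apply: measurable_sum => i; apply: (measurableT_comp mu_).
set A := [set w | _].
have mA : measurable A := measurable_gtr_cst (t * B) msum.
rewrite -[X in (Pr X <= _)%E]setIT -integral_indic//.
apply: (@le_trans _ _ (\int[Pr]_w (c * \prod_(i < n) expR (v (Xs i w)))%:E)%E).
  apply: ge0_le_integral => //.
  - exact/measurable_EFinP.
  - by apply/measurable_EFinP/measurable_funM.
  move=> w _; rewrite lee_fin indicE; case: (boolP (w \in A)) => [|_] /=.
    rewrite inE /A/= => h.
    rewrite -expR_sum -expRD -[leLHS]expR0 ler_expR.
    rewrite -mulr_suml -(ler_pM2r B0) mul0r.
    rewrite (_ : _ * B = \sum_(i < n) u (Xs i w) - n%:R * a - t * B).
      by rewrite subr_ge0 ltW.
    by field; rewrite gt_eqF.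
  by rewrite mulr_ge0 ?expR_ge0// prodr_ge0// => i _; rewrite expR_ge0.
under eq_integral do rewrite EFinM.
rewrite ge0_integralZl//; last 3 first.
- exact/measurable_EFinP.
- by move=> w _; rewrite lee_fin prodr_ge0// => i _; rewrite expR_ge0.
- by rewrite lee_fin expR_ge0.
rewrite hprod -EFinM lee_fin.
apply: (@le_trans _ _ (c * expR (a / B + 2 * (b / B ^+ 2)) ^+ n)).
  by rewrite ler_wpM2l ?expR_ge0// lerXn2r ?nnegrE ?expR_ge0.
rewrite -expRM_natl -expRD ler_expR.
have : 2 * n%:R * b / B ^+ 2 <= 1 by rewrite ler_pdivrMr ?exprn_gt0// mul1r.
set y := b / B ^+ 2; rewrite -mulrA -/y => hy.
by rewrite -mulr_natl; nra.
Qed.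

End tail.
(** * Chaining along dyadic nets *)

Lemma finite_union_bound {R : realType} {d} {Omega : measurableType d}
    (Pr : probability Omega R) (I : eqType) (s : seq I) (E : I -> set Omega)
    (b : R) :
  (forall i, i \in s -> measurable (E i) /\ (Pr (E i) <= b%:E)%E) ->
  exists B, [/\ measurable B, (Pr B <= ((size s)%:R * b)%:E)%E &
    forall i, i \in s -> E i `<=` B].
Proof.
elim: s => [|i s IH] h.
  by exists set0; split => //; rewrite measure0 mul0r.
have [|B [mB PB sB]] := IH.
  by move=> j js; apply: h; rewrite inE js orbT.
have [mE PE] := h i (mem_head _ _).
exists (E i `|` B); split.
- exact: measurableU.
- rewrite (le_trans (measureU2 Pr mE mB))// /= -natr1 mulrDl mul1r.
  by rewrite addrC EFinD leeD.
- move=> j; rewrite inE => /orP[/eqP->|js]; first exact: subsetUl.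
  exact: subset_trans (sB _ js) (@subsetUr _ _ _).
Qed.

Section chaining.
Context {R : realType} {dO} {Omega : measurableType dO}
  (Pr : probability Omega R) (Theta : eqType) (TT : set Theta)
  (close : R -> Theta -> Theta -> Prop) (G : Omega -> Theta -> R)
  (net : nat -> seq Theta) (a b : R).
Hypothesis mG : forall p, TT p -> measurable_fun setT (G ^~ p).
Hypothesis tail_point : forall p (t : R), TT p ->
  (Pr [set w | (G w p < - t)%R] <= (expR (1 - t))%:E)%E.
Hypothesis tail_link : forall p p' (delta t : R), 0 < delta -> TT p -> TT p' ->
  close delta p p' ->
  (Pr [set w | (G w p - G w p' < - (delta * t))%R] <= (expR (1 - t))%:E)%E.
Hypothesis a0 : 0 <= a.
Hypothesis b0 : 0 <= b.
Hypothesis net_sub : forall j p, p \in net j -> TT p.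
Hypothesis net_dense : forall j p, TT p ->
  exists2 p', p' \in net j & close (2 ^- j) p p'.
Hypothesis net_size : forall j, (size (net j))%:R <= expR (a + b * j%:R).

(** Each point of [net J.+1] is linked to a point of [net J] at distance at most
    2^-J, and the increment along that link exceeds 2^-J s with probability at
    most exp (1 - s).  The threshold [s] in the proof grows linearly in J: it
    absorbs the logarithm of the number of links and leaves a factor
    exp (- J - 1), which is summable.  The starting net costs kappa and the
    increments up to level J cost at most kappa times the sum of (j + 1) / 2^j
    over j < J; the closed form 4 - 2 (J + 2) / 2^J of that sum makes the
    induction close. *)
Lemma chaining_level (t : R) (J : nat) : 0 <= t ->
  let kappa := t + 2 * a + 2 * b + 1 in
  exists B, [/\ measurable B,
    (Pr B <= (expR (1 - t) * (2 - 2 ^- J))%:E)%E &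
    forall w, ~ B w -> forall p, p \in net J ->
      - (kappa * (5 - 2 * (J%:R + 2) * 2 ^- J)) <= G w p].
Proof.
move=> t0 kappa; elim: J => [|J [B [mB PB hB]]].
  have [|B [mB PB sB]] := @finite_union_bound _ _ _ Pr _ (net 0)
      (fun p => [set w | G w p < - (t + a)]) (expR (1 - (t + a))).
    by move=> p /net_sub Tp; split; [exact/measurable_ltr_cst/mG|exact: tail_point].
  exists B; split => //.
    apply: (le_trans PB); rewrite lee_fin expr0 invr1.
    apply: (@le_trans _ _ (expR a * expR (1 - (t + a)))).
      by rewrite ler_wpM2r ?expR_ge0//; have := net_size 0; rewrite mulr0 addr0.
    rewrite -expRD (_ : a + _ = 1 - t); last by ring.
    rewrite (_ : 2 - 1 = 1 :> R) ?mulr1//; ring.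
  move=> w nBw p pn; rewrite leNgt; apply/negP => h; apply: nBw.
  apply: (sB p pn) => /=; apply: (lt_le_trans h).
  rewrite lerN2 expr0 invr1 mulr0n /kappa (_ : 5 - 2 * (0 + 2) * 1 = 1); last by ring.
  have := a0; have := b0; lra.
(* Logarithms of the sizes of both nets, and J.+1 to make the levels summable. *)
pose s := t + (a + b * J%:R) + (a + b * J.+1%:R) + J.+1%:R.
pose bad (l : Theta * Theta) := [set w | close (2 ^- J) l.1 l.2 /\
  G w l.1 - G w l.2 < - (2 ^- J * s)].
have p2 : 0 < 2 ^- J :> R by rewrite invr_gt0 exprn_gt0.
have [|C [mC PC sC]] := @finite_union_bound _ _ _ Pr _
    [seq (p, p') | p <- net J.+1, p' <- net J] bad (expR (1 - s)).
  move=> _ /allpairsP[[p p'] /= [/net_sub Tp /net_sub Tp' ->]].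
  have [cl|ncl] := pselect (close (2 ^- J) p p'); last first.
    rewrite (_ : bad _ = set0); last by rewrite -subset0 => w [].
    by split => //; rewrite measure0 lee_fin expR_ge0.
  rewrite (_ : bad _ = [set w | G w p - G w p' < - (2 ^- J * s)]); last first.
    by apply/seteqP; split => w // [].
  split; last exact: tail_link.
  by apply: measurable_ltr_cst; apply: measurable_funB; exact: mG.
exists (B `|` C); split.
- exact: measurableU.
- rewrite (le_trans (measureU2 Pr mB mC))//.
  apply: (@le_trans _ _ ((expR (1 - t) * (2 - 2 ^- J))%:E +
     (expR (1 - t) * 2 ^- J.+1)%:E)%E); last first.
    rewrite -EFinD lee_fin -mulrDr ler_pM2l ?expR_gt0// exprSr invfM.
    by rewrite le_eqVlt; apply/orP; left; apply/eqP; field; rewrite expf_neq0.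
  rewrite leeD// (le_trans PC)// lee_fin size_allpairs natrM.
  apply: (@le_trans _ _ (expR (a + b * J.+1%:R) * expR (a + b * J%:R) *
     expR (1 - s))).
    by rewrite ler_wpM2r ?expR_ge0// ler_pM.
  rewrite -!expRD (_ : _ + (1 - s) = (1 - t) + - J.+1%:R); last by rewrite /s; ring.
  rewrite expRD ler_pM2l ?expR_gt0// expRN lef_pV2 ?posrE ?expR_gt0 ?exprn_gt0//.
  rewrite -[J.+1%:R]mulr1 expRM_natl lerXn2r ?nnegrE ?expR_ge0//.
  by rewrite (le_trans _ (expR_ge1Dx 1)).
move=> w /not_orP[nB nC] p pn.
have [p' p'n cl] := net_dense J (net_sub pn).
have h1 := hB w nB p' p'n.
have h2 : - (2 ^- J * s) <= G w p - G w p'.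
  rewrite leNgt; apply/negP => h; apply: nC.
  by apply: (sC (p, p')) => //; apply/allpairsP; exists (p, p').
have hs : s <= (J%:R + 1) * kappa.
  rewrite -subr_ge0 (_ : _ - _ = J%:R * t + 2 * (J%:R * a) + b).
    by rewrite !addr_ge0 ?mulr_ge0.
  rewrite /s /kappa -[J.+1%:R]natr1; ring.
have h3 : 2 ^- J * s <= 2 ^- J * ((J%:R + 1) * kappa) by rewrite ler_pM2l.
rewrite exprSr invfM -[J.+1%:R]natr1.
move: h1 h2 h3; set y := 2 ^- J; set z := J%:R.
rewrite (_ : 2 * (z + 1 + 2) * (y / 2) = (z + 3) * y); last by field.
nra.
Qed.

End chaining.

(** Cut the cube [-L, L]^q into cells of side 2^-j and keep one point of the set
    in each cell that it meets. *)
Lemma finite_nets {R : realType} (q : nat) (TT : set 'rV[R]_q) (L : nat) :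
  TT !=set0 -> (forall theta i, TT theta -> `|theta 0 i| <= L%:R) ->
  exists net : nat -> seq 'rV[R]_q, forall j,
    [/\ forall p, p \in net j -> TT p,
        forall theta, TT theta -> exists2 p, p \in net j &
          forall i, `|theta 0 i - p 0 i| <= 2 ^- j &
        (size (net j))%:R <= expR ((q * (2 * L))%:R + q%:R * j%:R) :> R].
Proof.
move=> [t0 Tt0] TL.
pose cell j (theta : 'rV[R]_q) : {ffun 'I_q -> 'I_(2 * L * 2 ^ j).+1} :=
  [ffun i => inord (Num.truncn ((theta 0 i + L%:R) * 2 ^+ j))].
exists (fun j => [seq xget t0 [set p | TT p /\ cell j p = c] |
  c <- enum {: {ffun 'I_q -> 'I_(2 * L * 2 ^ j).+1}}]) => j; split.
- by move=> p /mapP[c _ ->]; case: xgetP => [y _ []|].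
- move=> theta Tt.
  exists (xget t0 [set p | TT p /\ cell j p = cell j theta]).
    by apply: map_f; rewrite mem_enum.
  have : exists p, [set p | TT p /\ cell j p = cell j theta] p by exists theta.
  move=> /(@xgetPex _ t0) [Tp /ffunP Hc] i.
  set p := xget _ _ in Tp Hc *.
  have rng (v : 'rV[R]_q) : TT v -> 0 <= (v 0 i + L%:R) * 2 ^+ j /\
     (Num.truncn ((v 0 i + L%:R) * 2 ^+ j)%R <= 2 * L * 2 ^ j)%N.
    move=> /(TL _ i); rewrite ler_norml => /andP[v1 v2].
    have h0 : 0 <= (v 0 i + L%:R) * 2 ^+ j.
      by rewrite mulr_ge0 ?exprn_ge0// -lerBlDr sub0r.
    split => //; rewrite -(ler_nat R) (@le_trans _ _ ((v 0 i + L%:R) * 2 ^+ j)) ?truncn_le//.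
    by rewrite !natrM natrX ler_pM2r ?exprn_gt0//; lra.
  have := Hc i; rewrite !ffunE => /(congr1 val) /=.
  have [p0 pl] := rng _ Tp; have [v0 vl] := rng _ Tt.
  rewrite !inordK ?ltnS// => e.
  have /andP[] := truncn_itv p0; have /andP[] := truncn_itv v0.
  rewrite e -natr1; set k := (Num.truncn _)%:R => a1 a2 a3 a4.
  have p2 : 0 < 2 ^+ j :> R by rewrite exprn_gt0.
  rewrite -(ler_pM2r p2) mulVf ?gt_eqF// -(gtr0_norm p2) -normrM ler_norml.
  by apply/andP; split; nra.
- rewrite size_map -cardE card_ffun !card_ord natrX -mulr_natr.
  rewrite natrM -mulrDr expRM_natl lerXn2r ?nnegrE ?expR_ge0//.
  rewrite expRD -natr1 natrM.
  have h1 : (2 * L)%:R + 1 <= expR (2 * L)%:R :> R by rewrite addrC expR_ge1Dx.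
  have h2 : (2 ^ j)%:R <= expR j%:R :> R.
    rewrite natrX -[j%:R]mulr1 expRM_natl lerXn2r ?nnegrE ?expR_ge0//.
    by rewrite (le_trans _ (expR_ge1Dx 1)).
  have h3 : 1 <= (2 ^ j)%:R :> R by rewrite ler1n expn_gt0.
  have gen (x y u v : R) : 0 <= x -> 1 <= y -> x + 1 <= u -> y <= v ->
      x * y + 1 <= u * v by nra.
  by rewrite mul1r; exact: gen.
Qed.

(** * Uniform tightness of the empirical process *)

Section uniform_lower_bound.
Context {R : realType} {dO d} {Omega : measurableType dO}
  {T : measurableType d} (Pr : probability Omega R) (mu : probability T R)
  (Xs : nat -> {RV Pr >-> T}).
Hypothesis Xs_indep : independent_sequence Xs.
Hypothesis Xs_law : forall i A, measurable A -> Pr (Xs i @^-1` A) = mu A.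
Context (q : nat) (TT : set 'rV[R]_q) (L : nat) (H : T -> R).
Hypothesis TT0 : TT !=set0.
Hypothesis TL : forall theta i, TT theta -> `|theta 0 i| <= L%:R.
Hypothesis mH : measurable_fun setT H.
Hypothesis IH2 : mu.-integrable setT (EFin \o (fun x => H x ^+ 2)).

(** Truncation at B = M sqrt n followed by chaining.  Half of [eps] pays for the
    event that some H (X_i) exceeds B, which fixes M; the other half pays for
    the exceptional event of the chaining, which fixes the level t. *)
Lemma uniform_lower_bound (f : T -> 'rV[R]_q -> R) (eps : R) :
  (forall theta, TT theta -> measurable_fun setT (f ^~ theta)) ->
  (forall x theta, TT theta -> `|f x theta| <= H x) ->
  (forall x theta theta' (delta : R), 0 <= delta -> TT theta -> TT theta' ->
     (forall i, `|theta 0 i - theta' 0 i| <= delta) ->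
     `|f x theta - f x theta'| <= delta * H x) ->
  0 < eps ->
  exists K, forall n, (0 < n)%N -> exists A,
    [/\ measurable A, (Pr A <= eps%:E)%E &
      forall w, ~ A w -> forall theta, TT theta ->
        - (K * Num.sqrt n%:R) <=
          \sum_(i < n) f (Xs i w) theta - n%:R * \int[mu]_x f x theta].
Proof.
move=> mf fH fL eps0.
have H0 x : 0 <= H x by have [p /fH pH] := TT0; exact: le_trans (pH x).
have IH := integrable_of_sqr mH IH2.
pose h2 := \int[mu]_x (H x ^+ 2).
have h20 : 0 <= h2 by apply: Rintegral_ge0 => x _; exact: sqr_ge0.
(* Through M <= M^2 this gives both 2 E H^2 <= M^2, as the exponential tail
   requires, and E H^2 / M^2 <= eps / 2. *)
pose M := 1 + 2 * h2 + 2 * (h2 / eps).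
have he0 : 0 <= h2 / eps by rewrite divr_ge0// ltW.
have M1 : 1 <= M by rewrite /M; lra.
have M0 : 0 < M by lra.
have MM : M <= M ^+ 2 by rewrite expr2 ler_peMr// ltW.
have M2h : 2 * h2 <= M ^+ 2 by apply: le_trans MM; rewrite /M; lra.
have Meps : h2 / M ^+ 2 <= eps / 2.
  rewrite ler_pdivrMr ?exprn_gt0//.
  apply: (@le_trans _ _ (eps / 2 * M)); last by rewrite ler_pM2l// divr_gt0.
  rewrite /M !mulrDr (_ : eps / 2 * (2 * (h2 / eps)) = h2); last first.
    by field; rewrite gt_eqF.
  by have e0 := ltW eps0; rewrite lerDr addr_ge0// !mulr_ge0.
pose t := 1 + 4 / eps.
have t0 : 0 <= t by rewrite addr_ge0// divr_ge0// ltW.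
have teps : expR (1 - t) * 2 <= eps / 2.
  rewrite (_ : 1 - t = - (4 / eps)); last by rewrite /t; ring.
  have p4 : 0 < 4 / eps by rewrite divr_gt0.
  have : expR (- (4 / eps)) <= eps / 4.
    rewrite expRN -[eps / 4]invrK lef_pV2 ?posrE ?expR_gt0 ?invr_gt0 ?divr_gt0//.
    by rewrite invf_div (le_trans _ (expR_ge1Dx _))// lerDr.
  lra.
have [net hnet] := finite_nets TT0 TL.
pose a : R := (q * (2 * L))%:R; pose b : R := q%:R.
pose kappa := t + 2 * a + 2 * b + 1.
have a0 : 0 <= a by [].
have b0 : 0 <= b by [].
have kappa0 : 0 <= kappa by rewrite /kappa; lra.
(* In units of B: 5 kappa from the chaining, 1 each for replacing theta by a
   point of the net in the sum and in the mean, 1 for the truncated mean. *)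
exists ((5 * kappa + 3) * M) => n n0.
have sn0 : 0 < Num.sqrt n%:R :> R by rewrite sqrtr_gt0 ltr0n.
have sn2 : Num.sqrt n%:R ^+ 2 = n%:R :> R by rewrite sqr_sqrtr.
pose B := M * Num.sqrt n%:R.
have B0 : 0 < B by rewrite mulr_gt0.
have B2 : B ^+ 2 = M ^+ 2 * n%:R by rewrite exprMn sn2.
have nR0 : 0 < n%:R :> R by rewrite ltr0n.
have nh2 : 2 * n%:R * h2 <= B ^+ 2.
  by rewrite B2 mulrAC ler_wpM2r// ltW.
pose D : set T := [set x | H x <= B].
have DE : [set x | B < H x] = ~` D.
  by apply/seteqP; split => x /=; rewrite ltNge => /negP.
have mD : measurable D.
  by rewrite -[D]setCK -DE; apply: measurableC; exact: measurable_gtr_cst.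
pose g x theta := f x theta * \1_D x.
have mg theta : TT theta -> measurable_fun setT (g ^~ theta).
  by move=> /mf mft; apply: measurable_funM.
have HD0 x : 0 <= H x * \1_D x by rewrite mulr_ge0.
have HDH x : H x * \1_D x <= H x.
  by rewrite ler_piMr// indicE lern1 leq_b1.
have HDB x : H x * \1_D x <= B.
  rewrite indicE; case: (boolP (x \in D)); last by rewrite mulr0 ltW.
  by rewrite inE mulr1.
have sums_tail (u : T -> R) delta s : 0 < delta -> measurable_fun setT u ->
    (forall x, `|u x| <= delta * (H x * \1_D x)) ->
  (Pr [set w | (\sum_(i < n) u (Xs i w) - n%:R * \int[mu]_x u x <
     - (delta * s * B))%R] <= (expR (1 - s))%:E)%E.
  move=> delta0 mu_ ub.
  have uB x : `|u x| <= delta * B by rewrite (le_trans (ub x))// ler_pM2l.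
  have mNu : measurable_fun setT (fun x => - u x) by exact: measurable_funN.
  have Iu := integrable_bounded mu mu_ uB.
  have uN := RintegralN Iu.
  have := iid_sum_tail Xs_indep Xs_law (n := n) s (mulr_gt0 delta0 B0) mNu.
  rewrite uN => tailN.
  rewrite (_ : [set w | _] = [set w | s * (delta * B) <
      \sum_(i < n) - u (Xs i w) - n%:R * - \int[mu]_x u x]).
    apply: tailN; first by move=> x; rewrite normrN.
    apply: (@le_trans _ _ (2 * n%:R * (delta ^+ 2 * h2))).
      rewrite ler_wpM2l ?mulr_ge0// /h2 -RintegralZl//.
      have Iu2 : mu.-integrable setT (EFin \o (fun x => (- u x) ^+ 2)).
        apply: (@integrable_bounded _ _ _ mu _ ((delta * B) ^+ 2)).
          exact: measurable_funX.
        move=> x; rewrite normrX normrN lerXn2r ?nnegrE//.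
        by rewrite mulr_ge0// ltW.
      apply: le_Rintegral => //.
        exact: (integrableZl measurableT _ IH2).
      move=> x _; rewrite sqrrN -exprMn -[leLHS]real_normK ?num_real//.
      rewrite lerXn2r ?nnegrE ?mulr_ge0//; first exact: ltW.
      by rewrite (le_trans (ub x))// ler_pM2l.
    rewrite mulrCA exprMn ler_pM2l ?exprn_gt0//.
  by apply/seteqP; split => w /=; rewrite sumrN mulrN opprK ltrNr opprD opprK
    -mulrA mulrCA [- _ + _]addrC [_ - _]addrC.
pose G w theta := (\sum_(i < n) g (Xs i w) theta - n%:R * \int[mu]_x g x theta) / B.
have mG theta : TT theta -> measurable_fun setT (G ^~ theta).
  move=> /mg mgt; apply: measurable_funM => //; apply: measurable_funB => //.
  by apply: measurable_sum => i; apply: (measurableT_comp mgt).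
have gH x theta : TT theta -> `|g x theta| <= H x * \1_D x.
  by move=> Tt; rewrite normrM [`|\1_D x|]ger0_norm// ler_wpM2r// fH.
have gL x p p' delta : 0 <= delta -> TT p -> TT p' ->
    (forall i, `|p 0 i - p' 0 i| <= delta) ->
    `|g x p - g x p'| <= delta * (H x * \1_D x).
  move=> delta0 Tp Tp' cl; rewrite -mulrBl normrM [`|\1_D x|]ger0_norm// mulrA.
  by rewrite ler_wpM2r// fL.
have Ig theta : TT theta -> mu.-integrable setT (EFin \o g ^~ theta).
  move=> Tt; apply: (integrable_bounded mu (mg _ Tt)) => x.
  exact: (le_trans (gH x _ Tt)).
(* Level n is fine enough: 2^-n B summed over n terms is at most B. *)
have [|||||Bad [mBad PBad hBad]] := @chaining_level R _ _ Pr _ TT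
    (fun delta p p' => forall i, `|p 0 i - p' 0 i| <= delta) G net a b mG
    _ _ a0 b0 _ _ _ t n t0.
- move=> p s Tp; rewrite (_ : [set w | _] = [set w |
    \sum_(i < n) g (Xs i w) p - n%:R * \int[mu]_x g x p < - (1 * s * B)]).
    by apply: sums_tail => //; [exact: mg|move=> x; rewrite mul1r gH].
  by apply/seteqP; split => w /=; rewrite mul1r ltr_pdivrMr// mulNr.
- move=> p p' delta s delta0 Tp Tp' cl.
  rewrite (_ : [set w | _] = [set w |
    \sum_(i < n) (g (Xs i w) p - g (Xs i w) p') -
      n%:R * \int[mu]_x (g x p - g x p') < - (delta * s * B)]).
    apply: (sums_tail (fun x => g x p - g x p')) => //.
      by apply: measurable_funB; exact: mg.
    by move=> x; apply: gL => //; exact: ltW.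
  apply/seteqP; split => w /=; rewrite RintegralB//; try exact: Ig;
    rewrite sumrB /G -mulrBl ltr_pdivrMr// mulNr;
    by congr (is_true (_ < _)); ring.
- by move=> j p; have [+ _ _] := hnet j; exact.
- by move=> j p; have [_ + _] := hnet j; exact.
- by move=> j; have [_ _] := hnet j.
have [|C [mC PC hC]] := @finite_union_bound _ _ _ Pr _ (iota 0 n)
    (fun i => Xs i @^-1` [set x | B < H x]) (h2 / B ^+ 2).
  move=> i _.
  have mBH : measurable [set x | B < H x] by exact: measurable_gtr_cst.
  split; first exact: measurable_funPTI.
  by rewrite Xs_law//; exact: second_moment_tail.
exists (Bad `|` C); split.
- exact: measurableU.
- apply: (le_trans (measureU2 Pr mBad mC)).
  rewrite [eps]splitr EFinD leeD//.
    rewrite (le_trans PBad)// lee_fin (le_trans _ teps)//.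
    by rewrite ler_pM2l ?expR_gt0// lerBlDr lerDl invr_ge0 exprn_ge0.
  rewrite (le_trans PC)// lee_fin size_iota B2 (le_trans _ Meps)//.
  rewrite le_eqVlt; apply/orP; left; apply/eqP.
  by field; rewrite !gt_eqF.
move=> w /not_orP[nBad nC] theta Tt.
have fg (i : 'I_n) : f (Xs i w) theta = g (Xs i w) theta.
  rewrite /g indicE mem_set ?mulr1// /D/= leNgt; apply/negP => h.
  by apply: nC; apply: (hC i) => //; rewrite mem_iota/=.
under eq_bigr do rewrite fg.
have [p pn cl] : exists2 p, p \in net n & forall i, `|theta 0 i - p 0 i| <= 2 ^- n.
  by have [_ + _] := hnet n; exact.
have Tp : TT p by have [+ _ _] := hnet n; exact.
have p2 : 0 < 2 ^- n :> R by rewrite invr_gt0 exprn_gt0.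
have n2 : n%:R * 2 ^- n <= 1 :> R.
  rewrite ler_pdivrMr ?exprn_gt0// mul1r -natrX ler_nat ltnW// ltn_expl//.
(* The error in the mean due to truncation; n times it is at most B. *)
have trunc : `|\int[mu]_x f x theta - \int[mu]_x g x theta| <= h2 / B.
  rewrite -RintegralZr//; apply: Rintegral_dist_le; [exact: mf|exact: mg| | |].
  - apply: (integrable_dominated (mf _ Tt) _ IH) => x; exact: fH.
  - exact: (integrableZr measurableT _ IH2).
  move=> x; rewrite /g indicE; case: (boolP (x \in D)) => [_|].
    by rewrite mulr1 subrr normr0 divr_ge0 ?sqr_ge0// ltW.
  rewrite notin_setE /D/= => /negP; rewrite -ltNge => BH.
  rewrite mulr0 subr0 (le_trans (fH _ _ Tt))// ler_pdivlMr// expr2.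
  by rewrite ler_wpM2l// ltW.
have gdist x : `|g x theta - g x p| <= 2 ^- n * B.
  by rewrite (le_trans (gL _ _ _ _ (ltW p2) Tt Tp cl))// ler_pM2l.
have rdist : `|\int[mu]_x g x theta - \int[mu]_x g x p| <= 2 ^- n * B.
  have -> : 2 ^- n * B = \int[mu]_x cst (2 ^- n * B) x.
    by rewrite Rintegral_cst//= probability_setT mulr1.
  apply: Rintegral_dist_le; [exact: mg|exact: mg|exact: Ig| |exact: gdist].
  exact: finite_measure_integrable_cst.
have sdist : \sum_(i < n) g (Xs i w) p - n%:R * (2 ^- n * B) <=
    \sum_(i < n) g (Xs i w) theta.
  rewrite (_ : n%:R * _ = \sum_(i < n) (2 ^- n * B)); last first.
    by rewrite sumr_const card_ord mulr_natl.
  rewrite -sumrB ler_sum// => i _.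
  have := gdist (Xs i w); rewrite ler_norml => /andP[]; lra.
have := hBad w nBad p pn; rewrite -/kappa /G ler_pdivlMr//.
move: rdist trunc; rewrite !ler_norml => /andP[r1 r2] /andP[r3 r4].
set S := \sum_(i < n) g _ p in sdist *.
set S' := \sum_(i < n) g _ theta in sdist *.
set Ip := \int[mu]_x g x p in r1 r2 *.
set It := \int[mu]_x g x theta in r1 r2 r3 r4 *.
set If := \int[mu]_x f x theta in r3 r4 *.
move=> hS.
have e1 : - (kappa * 5 * B) <= S - n%:R * Ip.
  apply: le_trans hS; rewrite -mulNr ler_pM2r// lerN2 ler_wpM2l//.
  by rewrite lerBlDr lerDl mulr_ge0// ?mulr_ge0 ?addr_ge0 ?ltW.
have e2 : n%:R * (2 ^- n * B) <= B by rewrite mulrA ler_piMl// ltW.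
have e3 : n%:R * (It - Ip) <= n%:R * (2 ^- n * B) by rewrite ler_pM2l.
have e4 : n%:R * (If - It) <= n%:R * (h2 / B) by rewrite ler_pM2l.
have e5 : n%:R * (h2 / B) <= B.
  rewrite mulrA ler_pdivrMr// -expr2; have := mulr_ge0 (ltW nR0) h20; lra.
rewrite -mulrA -/B.
lra.
Qed.

End uniform_lower_bound.

Lemma uniform_bound {R : realType} {dO d} {Omega : measurableType dO}
    {T : measurableType d} (Pr : probability Omega R) (mu : probability T R)
    (Xs : nat -> {RV Pr >-> T}) (q : nat) (TT : set 'rV[R]_q) (L : nat)
    (H : T -> R) (f : T -> 'rV[R]_q -> R) (eps : R) :
  independent_sequence Xs ->
  (forall i A, measurable A -> Pr (Xs i @^-1` A) = mu A) ->
  TT !=set0 ->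
  (forall theta i, TT theta -> `|theta 0 i| <= L%:R) ->
  measurable_fun setT H ->
  mu.-integrable setT (EFin \o (fun x => H x ^+ 2)) ->
  (forall theta, TT theta -> measurable_fun setT (f ^~ theta)) ->
  (forall x theta, TT theta -> `|f x theta| <= H x) ->
  (forall x theta theta' (delta : R), 0 <= delta -> TT theta -> TT theta' ->
     (forall i, `|theta 0 i - theta' 0 i| <= delta) ->
     `|f x theta - f x theta'| <= delta * H x) ->
  0 < eps ->
  exists K, forall n, (0 < n)%N -> exists A,
    [/\ measurable A, (Pr A <= eps%:E)%E &
      forall w, ~ A w -> forall theta, TT theta ->
        `|\sum_(i < n) f (Xs i w) theta - n%:R * \int[mu]_x f x theta|
          <= K * Num.sqrt n%:R].
Proof.
move=> ind law TT0 TL mH IH2 mf fH fL eps0.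
have eps20 : 0 < eps / 2 by rewrite divr_gt0.
have [K1 h1] := uniform_lower_bound ind law TT0 TL mH IH2 mf fH fL eps20.
have [||| K2 h2] := uniform_lower_bound (f := fun x theta => - f x theta)
  ind law TT0 TL mH IH2 _ _ _ eps20.
- by move=> theta Tt; apply: measurable_funN; exact: mf.
- by move=> x theta Tt; rewrite normrN fH.
- move=> x theta theta' delta d0 Tt Tt' cl.
  by rewrite -opprD normrN fL.
exists (Num.max K1 K2) => n n0.
have [A1 [mA1 PA1 hA1]] := h1 n n0; have [A2 [mA2 PA2 hA2]] := h2 n n0.
exists (A1 `|` A2); split.
- exact: measurableU.
- by rewrite (le_trans (measureU2 Pr mA1 mA2))// [eps]splitr EFinD leeD.
move=> w /not_orP[n1 n2] theta Tt.
have If : mu.-integrable setT (EFin \o f ^~ theta).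
  apply: (integrable_dominated (mf _ Tt) _ (integrable_of_sqr mH IH2)) => x.
  exact: fH.
have rN := RintegralN If.
have a1 := hA1 w n1 theta Tt; have := hA2 w n2 theta Tt.
rewrite rN sumrN => a2.
have s0 : 0 <= Num.sqrt n%:R :> R by exact: sqrtr_ge0.
have b1 : K1 * Num.sqrt n%:R <= Num.max K1 K2 * Num.sqrt n%:R.
  by rewrite ler_wpM2r// le_max lexx.
have b2 : K2 * Num.sqrt n%:R <= Num.max K1 K2 * Num.sqrt n%:R.
  by rewrite ler_wpM2r// le_max lexx orbT.
rewrite ler_norml; apply/andP; split; lra.
Qed.

(** * Convergence rate of the minimal empirical risk *)

Lemma minimumE (disp : Order.disp_t) (T : porderType disp) (t0 a : T)
    (A : set T) : A a -> lbound A a -> minimum t0 A = a.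
Proof.
move=> Aa la; rewrite /minimum; case: xgetP => [y _ [Ay ly]|/(_ a)].
  by apply: le_anti; rewrite ly// la.
by case.
Qed.

Lemma lipschitz_attains_min {R : realType} (q : nat) (TT : set 'rV[R]_q)
    (r : 'rV[R]_q -> R) (c : R) :
  TT !=set0 -> compact TT -> 0 <= c ->
  (forall theta theta' (delta : R), 0 <= delta -> TT theta -> TT theta' ->
    (forall i, `|theta 0 i - theta' 0 i| <= delta) ->
    `|r theta - r theta'| <= delta * c) ->
  exists2 t, TT t & forall theta, TT theta -> r t <= r theta.
Proof.
move=> TT0 cTT c0 rL.
have [|t] := @compact_EVT_min _ _ r TT TT0 cTT.
  apply/subspace_continuousP => x Tx; apply/cvgrPdist_le => e e0.
  rewrite near_withinE; have p : 0 < e / (c + 1).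
    by rewrite divr_gt0// ltr_pwDr.
  have := nbhsx_ballx x _ p; apply: filterS => y [_ xy] Ty.
  apply: (@le_trans _ _ (e / (c + 1) * c)).
    apply: rL => //; first exact: ltW.
    by move=> i; apply: ltW; exact: xy.
  rewrite mulrAC ler_pdivrMr ?ltr_pwDr// ler_pM2l//; lra.
by rewrite inE => Tt h; exists t => // theta Tth; apply: h; rewrite inE.
Qed.

Lemma euclidean_norm_le {R : realType} (q : nat) (v : 'rV[R]_q) (delta : R) :
  0 <= delta -> (forall i, `|v 0 i| <= delta) ->
  euclidean_norm v <= q%:R * delta.
Proof.
move=> d0 vd; rewrite /euclidean_norm.
rewrite -[leRHS]ger0_norm ?mulr_ge0// -sqrtr_sqr ler_wsqrtr//.
apply: (@le_trans _ _ (\sum_(i < q) delta ^+ 2)).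
  apply: ler_sum => i _; rewrite -[leLHS]real_normK ?num_real//.
  by rewrite lerXn2r ?nnegrE.
rewrite sumr_const card_ord exprMn -[leLHS]mulr_natl ler_wpM2r ?sqr_ge0//.
by rewrite -natrX ler_nat; case: (q) => // k; rewrite leq_pmulr.
Qed.

Lemma compact_coord_bounded {R : realType} (q : nat) (TT : set 'rV[R]_q) :
  compact TT ->
  exists L : nat, forall theta i, TT theta -> `|theta 0 i| <= L%:R.
Proof.
move=> /compact_bounded[M [Mr hM]].
exists (Num.truncn (`|M| + 1)).+1 => theta i Tt.
have : `|theta| <= `|M| + 1.
  by apply: hM => //; rewrite (le_lt_trans (ler_norm _))// ltrDl.
move=> h; apply: le_trans (ltW (truncnS_gt _)); apply: le_trans h.
by rewrite [`|theta|]mx_normrE; exact: (le_bigmax _ (fun ij => `|theta ij.1 ij.2|) (0, i)).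
Qed.

Section hypothesis_rate.
Context {R : realType} {dO d} {Omega : measurableType dO}
  {T : measurableType d} (Pr : probability Omega R) (X : {RV Pr >-> T})
  (Xs : nat -> {RV Pr >-> T}).
Hypothesis Xs_indep : independent_sequence Xs.
Hypothesis Xs_ident : forall i, same_distribution (Xs i) X.

(** The loss is Lipschitz in the parameter only outside a null set [N] of data.
    It is replaced by 0 on [N], which changes neither the expected risks nor,
    almost surely, the empirical ones; the modified loss [f] has an everywhere
    valid envelope [H] which is also its Lipschitz constant. *)
Lemma min_risk_rate (q : nat) (TT : set 'rV[R]_q) (loss : T -> 'rV[R]_q -> R) :
  (forall theta, TT theta -> measurable_fun setT (loss ^~ theta)) ->
  compact TT ->
  (exists tau, TT tau /\ ('E_Pr[fun w => (loss (X w) tau ^+ 2)%R] < +oo)%E) ->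
  (exists C : T -> R,
     [/\ measurable_fun setT C,
         forall x, 0 <= C x,
         ('E_Pr[fun w => (C (X w) ^+ 2)%R] < +oo)%E &
         {ae distribution Pr X, forall x, forall theta tau,
            TT theta -> TT tau ->
            `|loss x theta - loss x tau|
              <= C x * euclidean_norm (theta - tau)}]) ->
  exists rho : R, minimum 0%E (expected_risk Pr loss X @` TT) = rho%:E /\
    forall eps, 0 < eps -> exists K, forall n, (0 < n)%N -> exists A,
      [/\ measurable A, (Pr A <= eps%:E)%E &
        forall w, ~ A w ->
          `|minimum 0 (empirical_risk loss Xs n w @` TT) - rho|
            <= K / Num.sqrt n%:R].
Proof.
move=> ml cTT [tau [Ttau ltau]] [C [mC C0 C2 [N [mN PN hN]]]].
pose mu : probability T R := distribution Pr X.
have TT0 : TT !=set0 by exists tau.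
have law i A : measurable A -> Pr (Xs i @^-1` A) = mu A.
  exact: Xs_ident.
have [L TL] := compact_coord_bounded cTT.
pose f x theta := loss x theta * \1_(~` N) x.
(* Points of TT differ by at most 2 L in each coordinate: the first term of b
   makes H an envelope, the second one a Lipschitz constant. *)
pose b : R := q%:R * (2 * L%:R) + q%:R.
pose H x := `|loss x tau| + b * C x.
have b0 : 0 <= b by rewrite addr_ge0// !mulr_ge0.
have good x : ~ N x -> forall theta theta', TT theta -> TT theta' ->
    `|loss x theta - loss x theta'| <= C x * euclidean_norm (theta - theta').
  by move=> nN; apply: contrapT => h; apply/nN/hN.
have H0 x : 0 <= H x by rewrite addr_ge0// mulr_ge0.
have mlt : measurable_fun setT (loss ^~ tau) := ml _ Ttau.
have mH : measurable_fun setT H.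
  apply: measurable_funD; first exact: measurableT_comp.
  exact: measurable_funM.
have mNC : measurable (~` N) by exact: measurableC.
have mf theta : TT theta -> measurable_fun setT (f ^~ theta).
  by move=> Tt; apply: measurable_funM => //; exact: ml.
have fL x theta theta' (delta : R) : 0 <= delta -> TT theta -> TT theta' ->
     (forall i, `|theta 0 i - theta' 0 i| <= delta) ->
     `|f x theta - f x theta'| <= delta * H x.
  move=> d0 Tt Tt' cl; rewrite /f indicE; case: (boolP (x \in ~` N)); last first.
    by rewrite !mulr0 subr0 normr0 mulr_ge0.
  rewrite inE => /good/(_ _ _ Tt Tt') h; rewrite !mulr1 (le_trans h)//.
  apply: (@le_trans _ _ (C x * (q%:R * delta))).
    rewrite ler_wpM2l// euclidean_norm_le// => i.
    by rewrite !mxE.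
  rewrite (_ : C x * _ = delta * (q%:R * C x)); last by ring.
  rewrite ler_wpM2l// /H /b.
  have := normr_ge0 (loss x tau); have := C0 x.
  have : 0 <= (q%:R * (2 * L%:R)) * C x by rewrite !mulr_ge0.
  rewrite mulrDl; lra.
have fH x theta : TT theta -> `|f x theta| <= H x.
  move=> Tt; rewrite /f indicE; case: (boolP (x \in ~` N)); last first.
    by rewrite mulr0 normr0.
  rewrite inE => /good/(_ _ _ Tt Ttau) h; rewrite mulr1.
  rewrite -[loss x theta](subrK (loss x tau)) (le_trans (ler_normD _ _))//.
  rewrite addrC lerD2l (le_trans h)// mulrC ler_wpM2r//.
  rewrite (le_trans (@euclidean_norm_le _ _ _ (2 * L%:R) _ _))// ?mulr_ge0//.
    move=> i; rewrite !mxE (le_trans (ler_normB _ _))//.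
    by have := TL _ i Tt; have := TL _ i Ttau; lra.
  by rewrite /b lerDl.
have I2 (g : T -> R) : measurable_fun setT g ->
    ('E_Pr[fun w => (g (X w) ^+ 2)%R] < +oo)%E ->
    mu.-integrable setT (EFin \o (fun x => g x ^+ 2)).
  move=> mg; rewrite unlock => Eg; apply/integrableP; split.
    by apply/measurable_EFinP; exact: measurable_funX.
  under eq_integral do rewrite /= ger0_norm ?sqr_ge0//.
  rewrite ge0_integral_distribution//; last by move=> y; rewrite lee_fin sqr_ge0.
  by apply/measurable_EFinP; exact: measurable_funX.
have IH2 : mu.-integrable setT (EFin \o (fun x => H x ^+ 2)).
  have J1 := integrableZl measurableT 2 (I2 _ mlt ltau).
  have J2 := integrableZl measurableT (2 * b ^+ 2) (I2 _ mC C2).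
  apply: (integrable_dominated _ _ (integrableD measurableT J1 J2)).
    exact: measurable_funX.
  move=> x; rewrite ger0_norm ?sqr_ge0// /H.
  have := sqr_ge0 (`|loss x tau| - b * C x).
  have : `|loss x tau| ^+ 2 = loss x tau ^+ 2 by rewrite real_normK ?num_real.
  nra.
have IH := integrable_of_sqr mH IH2.
have If theta : TT theta -> mu.-integrable setT (EFin \o f ^~ theta).
  by move=> Tt; apply: (integrable_dominated (mf _ Tt) _ IH) => x; exact: fH.
pose r theta := \int[mu]_x f x theta.
have rE theta : TT theta -> expected_risk Pr loss X theta = (r theta)%:E.
  move=> Tt; rewrite /expected_risk unlock /r -integral_Rintegral; last exact: If.
  rewrite integral_distribution//; last 2 first.
  - by apply/measurable_EFinP; exact: mf.
  - apply/integrableP; split.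
      apply/measurable_EFinP.
      by apply: (measurableT_comp (mf _ Tt)).
    rewrite -(ge0_integral_distribution X (f := fun x => `|(f x theta)%:E|%E))//.
      by have /integrableP[] := If _ Tt.
    by apply: measurableT_comp => //; apply/measurable_EFinP; exact: mf.
  apply: ae_eq_integral => //.
  - by apply/measurable_EFinP; apply: (measurableT_comp (ml _ Tt)).
  - by apply/measurable_EFinP; apply: (measurableT_comp (mf _ Tt)).
  exists (X @^-1` N); split => //.
    exact: measurable_funPTI.
  move=> w /= /not_implyP[_ h]; apply: contrapT => nN; apply: h.
  by rewrite /f indicE mem_set ?mulr1.
pose cH := \int[mu]_x H x.
have cH0 : 0 <= cH by apply: Rintegral_ge0 => x _.
have [t0 Tt0 ht0] : exists2 t, TT t & forall theta, TT theta -> r t <= r theta.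
  apply: (lipschitz_attains_min TT0 cTT cH0) => theta theta' delta d0 Tt Tt' cl.
  rewrite /cH -RintegralZl//; apply: Rintegral_dist_le; [exact: mf|exact: mf|exact: If| |].
    exact: (integrableZl measurableT _ IH).
  by move=> x; exact: fL.
exists (r t0); split.
  apply: minimumE; first by exists t0 => //; exact: rE.
  by move=> _ [theta Tt <-]; rewrite rE// lee_fin ht0.
move=> eps eps0.
have [K hK] := uniform_bound Xs_indep law TT0 TL mH IH2 mf fH fL eps0.
exists K => n n0; have [A [mA PA hA]] := hK n n0.
have [|B [mB PB hB]] := @finite_union_bound _ _ _ Pr _ (iota 0 n)
    (fun i => Xs i @^-1` N) 0.
  move=> i _; split.
    exact: measurable_funPTI.
  by rewrite (etrans (law i N mN) PN).
exists (A `|` B); split.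
- exact: measurableU.
- rewrite (le_trans (measureU2 Pr mA mB))// -[eps%:E]adde0 leeD//.
  by rewrite (le_trans PB)// mulr0.
move=> w /not_orP[nA nB].
have nR0 : 0 < n%:R :> R by rewrite ltr0n.
have lf (i : 'I_n) theta : loss (Xs i w) theta = f (Xs i w) theta.
  rewrite /f indicE mem_set ?mulr1// => h.
  by apply: nB; apply: (hB i) => //; rewrite mem_iota/=.
have eE theta : empirical_risk loss Xs n w theta =
    n%:R^-1 * \sum_(i < n) f (Xs i w) theta.
  by rewrite /empirical_risk; congr (_ * _); apply: eq_bigr => i _; exact: lf.
have close theta : TT theta ->
    `|empirical_risk loss Xs n w theta - r theta| <= K / Num.sqrt n%:R.
  move=> /(hA w nA theta) h.
  have s0 : 0 < Num.sqrt n%:R :> R by rewrite sqrtr_gt0.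
  have s2 : Num.sqrt n%:R * Num.sqrt n%:R = n%:R :> R by rewrite -expr2 sqr_sqrtr.
  rewrite -(ler_pM2l nR0) -{1}(gtr0_norm nR0) -normrM mulrBr eE mulVKf ?gt_eqF//.
  rewrite (_ : n%:R * (K / _) = K * Num.sqrt n%:R)//.
  by rewrite -{1}s2; field; rewrite gt_eqF.
have [t1 Tt1 ht1] : exists2 t, TT t & forall theta, TT theta ->
    empirical_risk loss Xs n w t <= empirical_risk loss Xs n w theta.
  pose c := n%:R^-1 * \sum_(i < n) H (Xs i w).
  have c0 : 0 <= c by rewrite mulr_ge0 ?invr_ge0// sumr_ge0.
  apply: (lipschitz_attains_min TT0 cTT c0) => theta theta' delta d0 Tt Tt' cl.
  rewrite !eE -mulrBr -sumrB normrM ger0_norm ?invr_ge0// /c mulrCA.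
  rewrite ler_wpM2l ?invr_ge0// mulr_sumr (le_trans (ler_norm_sum _ _ _))//.
  by apply: ler_sum => i _; exact: fL.
rewrite (minimumE _ (a := empirical_risk loss Xs n w t1)); last 2 first.
- by exists t1.
- by move=> _ [theta Tt <-]; exact: ht1.
have := close _ Tt0; have := close _ Tt1; have := ht1 _ Tt0; have := ht0 _ Tt1.
rewrite !ler_norml => a1 a2 /andP[a3 a4] /andP[a5 a6].
apply/andP; split; lra.
Qed.

End hypothesis_rate.

(** * Least indices of minimisers *)

Lemma min_argmin_unique (disp : Order.disp_t) (T : orderType disp) (m : nat)
    (f : 'I_m.+1 -> T) (k : 'I_m.+1) :
  (forall j, j != k -> (f k < f j)%O) -> min_argmin f = k.
Proof.
move=> h; have le_k j : (f k <= f j)%O.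
  by have [->|/h/ltW] := eqVneq j k.
apply: minimumE => // j hj; have [->//|/h] := eqVneq j k.
by rewrite ltNge hj.
Qed.

Lemma min_argminP (disp : Order.disp_t) (T : orderType disp) (m : nat)
    (f : 'I_m.+1 -> T) :
  (forall j, (f (min_argmin f) <= f j)%O) /\
  (forall k : 'I_m.+1, (k < min_argmin f)%N -> (f (min_argmin f) < f k)%O).
Proof.
pose is_min (k : 'I_m.+1) := [forall j, (f k <= f j)%O].
have min0 : is_min [arg min_(k < ord0) f k]%O.
  by apply/forallP => j; case: arg_minP => // k _ /(_ j isT).
case: (arg_minnP (fun k : 'I_m.+1 => val k) min0) => k /forallP kmin kleast.
have kE : min_argmin f = k.
  by apply: minimumE => // j hj; rewrite leEord; apply/kleast/forallP.
rewrite kE; split => // j jk; rewrite ltNge; apply/negP => jmin.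
have := kleast j; rewrite leqNgt jk => /(_ _)/negP; apply => //.
by apply/forallP => i; exact: le_trans (kmin i).
Qed.

(** * Events of probability close to one *)

Section likely.
Context {R : realType} {dO} {Omega : measurableType dO}
  (Pr : probability Omega R).

(** A bad event [A] is required to be measurable, the sets [E n] are not: the
    event that the estimator is correct involves infima over uncountably many
    parameters. *)
Definition likely (eps : R) (E : nat -> set Omega) :=
  \forall n \near \oo, exists A,
    [/\ measurable A, (Pr A <= eps%:E)%E & forall w, ~ A w -> E n w].

Lemma likelyI (e1 e2 : R) (E1 E2 : nat -> set Omega) :
  likely e1 E1 -> likely e2 E2 -> likely (e1 + e2) (fun n => E1 n `&` E2 n).
Proof.
move=> h1 h2; rewrite /likely; near=> n.
have [A1 [mA1 PA1 hA1]] : exists A, [/\ measurable A, (Pr A <= e1%:E)%E &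
    forall w, ~ A w -> E1 n w] by near: n; exact: h1.
have [A2 [mA2 PA2 hA2]] : exists A, [/\ measurable A, (Pr A <= e2%:E)%E &
    forall w, ~ A w -> E2 n w] by near: n; exact: h2.
exists (A1 `|` A2); split; first exact: measurableU.
  by rewrite (le_trans (measureU2 Pr mA1 mA2))// EFinD leeD.
by move=> w /not_orP[nA1 nA2]; split; [exact: hA1|exact: hA2].
Unshelve. all: by end_near. Qed.

Lemma likely_forall (m : nat) (E : 'I_m.+1 -> nat -> set Omega) (eps : R) :
  (forall k eta, 0 < eta -> likely eta (E k)) -> 0 < eps ->
  likely eps (fun n w => forall k, E k n w).
Proof.
move=> h eps0; pose eta := eps / m.+1%:R.
have eta0 : 0 < eta by rewrite divr_gt0.
have : \forall n \near \oo, forall k, exists A,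
    [/\ measurable A, (Pr A <= eta%:E)%E & forall w, ~ A w -> E k n w].
  by apply: filter_forall => k; exact: h.
apply: filterS => n /choice[A hA].
have [|B [mB PB hB]] := @finite_union_bound _ _ _ Pr _ (enum 'I_m.+1) A eta.
  by move=> k _; have [] := hA k.
exists B; split => //.
  rewrite (le_trans PB)// lee_fin size_enum_ord /eta mulrC mulfVK//.
move=> w nB k; have [_ _] := hA k; apply => Akw.
by apply: nB; apply: (hB k) => //; rewrite mem_enum.
Qed.

Lemma inner_probability_cvg1 (E : nat -> set Omega) :
  (forall eps, 0 < eps -> likely eps E) ->
  inner_probability Pr (E n) @[n --> \oo] --> 1%E.
Proof.
move=> h.
have le1 n : (inner_probability Pr (E n) <= 1)%E.
  by apply: ge_ereal_sup => _ [B [mB _] <-]; exact: probability_le1.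
have ge0 n : (0 <= inner_probability Pr (E n))%E.
  apply: ereal_sup_ubound; exists set0; last by rewrite measure0.
  by split => //; exact: sub0set.
have fin n : inner_probability Pr (E n) \is a fin_num.
  by rewrite ge0_fin_numE// (le_lt_trans (le1 n))// ltry.
apply/fine_cvgP; split; first by near=> n; exact: fin.
apply/cvgrPdist_le => e e0; apply: filterS (h e e0) => n [A [mA PA hA]].
have : (1 - Pr A <= inner_probability Pr (E n))%E.
  apply: ereal_sup_ubound; exists (~` A); last by rewrite probability_setC.
  by split; [exact: measurableC|].
have PAf : Pr A \is a fin_num by rewrite fin_num_measure.
move: PA; rewrite -(fineK PAf) lee_fin -EFinB -{1}(fineK (fin n)) lee_fin => p1 p2.
rewrite ger0_norm ?subr_ge0; last by rewrite -lee_fin fineK.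
rewrite /=; lra.
Unshelve. all: by end_near. Qed.

Lemma likely_small (Z : nat -> {RV Pr >-> R}) (e eps : R) :
  cvg0_in_probability Pr (fun n => Z n) -> 0 < e -> 0 < eps ->
  likely eps (fun n w => Z n w <= e).
Proof.
move=> cZ e0 eps0.
have near0 : \forall n \near \oo, (Pr [set w | (e < `|Z n w|)%R] < eps%:E)%E.
  exact: (cZ e e0 _ (nbhs_open_ereal_lt (r := 0) (f := fun=> eps) eps0)).
apply: filterS near0 => n h.
exists [set w | e < `|Z n w|]; split; last 2 first.
- exact: ltW.
- by move=> w /= /negP; rewrite -leNgt; apply: le_trans; exact: ler_norm.
have mZ : measurable_fun setT (fun w => `|Z n w|) by exact: measurableT_comp.
exact: measurable_gtr_cst.
Qed.

Lemma likely_large (Z : nat -> Omega -> R) (M eps : R) :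
  (forall n, measurable_fun setT (Z n)) ->
  cvg_pinfty_in_probability Pr Z -> 0 < M -> 0 < eps ->
  likely eps (fun n w => M < Z n w).
Proof.
move=> mZ cZ M0 eps0.
have e1 : 1 - eps < 1 :> R by rewrite ltrBlDr ltrDl.
have near1 : \forall n \near \oo, ((1 - eps)%:E < Pr [set w | (M < Z n w)%R])%E.
  exact: (cZ M M0 _ (nbhs_open_ereal_gt (r := 1) (f := fun=> 1 - eps) e1)).
apply: filterS near1 => n h.
have mS : measurable [set w | M < Z n w] by exact: measurable_gtr_cst.
exists (~` [set w | M < Z n w]); split.
- exact: measurableC.
- rewrite probability_setC//.
  have Pf : Pr [set w | M < Z n w] \is a fin_num by rewrite fin_num_measure.
  move: h; rewrite -(fineK Pf) lte_fin -EFinB lee_fin; lra.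
- by move=> w /contrapT.
Qed.

End likely.

Lemma near_lt_sqrt {R : realType} (c : R) :
  \forall n \near \oo, c < Num.sqrt n%:R.
Proof.
apply: filterS (nbhs_infty_gtr (c ^+ 2)) => n h.
rewrite (le_lt_trans (ler_norm c))// -sqrtr_sqr ltr_sqrt//.
by rewrite (le_lt_trans _ h)// sqr_ge0.
Qed.

(** * Consistency of the estimated index *)

Theorem theorem1 (R : realType)
  (dO : measure_display) (Omega : measurableType dO) (Pr : probability Omega R)
  (d : nat) (XX : set 'rV[R]_d) (x0 : XX)
  (X : {RV Pr >-> borel_on x0}) (Xs : nat -> {RV Pr >-> borel_on x0})
  (m : nat) (q : 'I_m.+1 -> nat) (TT : forall k, set 'rV[R]_(q k))
  (h : forall k, borel_on x0 -> 'rV[R]_(q k) -> R) (l : R -> R)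
  (pen : 'I_m.+1 -> nat -> {RV Pr >-> R})
  (loss := fun k (x : borel_on x0) (theta : 'rV[R]_(q k)) => l (h k x theta))
  (loss_meas : forall k theta, TT k theta ->
     measurable_fun [set: borel_on x0] (fun x => loss k x theta))
  (pen_ge0 : forall k n w, (0 < n)%N -> 0 <= pen k n w)
  (Xs_indep : independent_sequence Xs)
  (Xs_ident : forall i, same_distribution (Xs i) X)
  (A1 : forall k, compact (TT k) /\
     exists tau, TT k tau /\ ('E_Pr[fun w => (loss k (X w) tau ^+ 2)%R] < +oo)%E)
  (A2 : forall k, exists C : borel_on x0 -> R,
     [/\ measurable_fun [set: borel_on x0] C,
         forall x, 0 <= C x,
         ('E_Pr[fun w => (C (X w) ^+ 2)%R] < +oo)%E &
         {ae distribution Pr X, forall x, forall theta tau,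
            TT k theta -> TT k tau ->
            `|loss k x theta - loss k x tau|
              <= C x * euclidean_norm (theta - tau)}])
  (B1 : forall k,
     (forall n w, (0 < n)%N -> 0 < pen k n w) /\
     cvg0_in_probability Pr (fun n => pen k n))
  (B2 : forall k k' : 'I_m.+1, (k < k')%N ->
     cvg_pinfty_in_probability Pr
       (fun n w => Num.sqrt n%:R * (pen k' n w - pen k n w))) :
  inner_probability Pr
    [set w | estimated_index TT loss Xs pen n w
             = optimal_index Pr TT loss X] @[n --> \oo] --> 1%E.
Proof.
have /choice[rho rhoP] k : exists rho : R,
    minimum 0%E (expected_risk Pr (loss k) X @` TT k) = rho%:E /\
    forall eps, 0 < eps -> exists K, forall n, (0 < n)%N -> exists A,
      [/\ measurable A, (Pr A <= eps%:E)%E &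
        forall w, ~ A w ->
          `|minimum 0 (empirical_risk (loss k) Xs n w @` TT k) - rho|
            <= K / Num.sqrt n%:R].
  have [cT tauP] := A1 k.
  exact: (min_risk_rate Xs_indep Xs_ident (@loss_meas k) cT tauP (A2 k)).
pose Rhat k n w := minimum 0 (empirical_risk (loss k) Xs n w @` TT k).
have rate k eps : 0 < eps -> exists K,
    likely Pr eps (fun n w => `|Rhat k n w - rho k| <= K / Num.sqrt n%:R).
  move=> eps0; have [_ /(_ eps eps0)[K hK]] := rhoP k.
  by exists K; exists 1%N.
set ks := optimal_index Pr TT loss X.
(* The minimal risks are finite, so the comparison takes place in R. *)
have [ks_min ks_least] : (forall j, rho ks <= rho j) /\
    (forall j : 'I_m.+1, (j < ks)%N -> rho ks < rho j).
  have := min_argminP (fun k => minimum 0%E (expected_risk Pr (loss k) X @` TT k)).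
  rewrite -/(optimal_index _ _ _ _) -/ks => -[a b]; split => j.
    by have := a j; rewrite !(rhoP _).1 lee_fin.
  by move=> /b; rewrite !(rhoP _).1 lte_fin.
apply: inner_probability_cvg1 => eps eps0.
suff beats k eta : 0 < eta -> likely Pr eta (fun n w => k != ks ->
    Rhat ks n w + pen ks n w < Rhat k n w + pen k n w).
  apply: filterS (likely_forall beats eps0) => n [A [mA PA hA]].
  exists A; split => // w nA /=.
  by apply: min_argmin_unique => k; exact: hA.
move=> eta0; have [->|kks] := eqVneq k ks.
  by exists 0%N => // n _; exists set0; split; rewrite ?measure0 ?lee_fin ?ltW.
have eta30 : 0 < eta / 3 by rewrite divr_gt0.
have [K1 rate1] := rate ks _ eta30.
have [K2 rate2] := rate k _ eta30.
have le_div (K s : R) : 0 <= s -> K / s <= `|K| / s.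
  by move=> s0; rewrite ler_wpM2r ?invr_ge0// ler_norm.
have := ks_min k; rewrite le_eqVlt => /orP[/eqP rhoE|rho_lt].
  have ks_lt : (ks < k)%N.
    rewrite ltn_neqAle eq_sym (inj_eq val_inj) kks /= leqNgt.
    by apply/negP => /ks_least; rewrite rhoE ltxx.
  pose M := `|K1| + `|K2| + 1.
  have M0 : 0 < M by rewrite ltr_pwDr.
  have mdiff n : measurable_fun setT
      (fun w => Num.sqrt n%:R * (pen k n w - pen ks n w)).
    by apply: measurable_funM => //; exact: measurable_funB.
  have big := likely_large mdiff (B2 _ _ ks_lt) M0 eta30.
  have := likelyI (likelyI rate1 rate2) big.
  rewrite (_ : eta / 3 + eta / 3 + eta / 3 = eta); last by field.
  apply: filterS2 (near_lt_sqrt 0) => n sn0 [A [mA PA hA]].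
  exists A; split => // w /hA[[r1 r2] pk] _.
  have {}sn0 : 0 < Num.sqrt (n%:R : R) := sn0.
  set s := Num.sqrt (n%:R : R) in sn0 r1 r2 pk.
  move: r1 r2; rewrite !ler_norml => /andP[_ r1] /andP[r2 _].
  have k1 := le_div K1 s (ltW sn0).
  have k2 := le_div K2 s (ltW sn0).
  have : (`|K1| + `|K2|) / s < pen k n w - pen ks n w.
    by rewrite ltr_pdivrMr// mulrC (lt_trans _ pk)// /M ltrDl.
  rewrite mulrDl; lra.
pose gap := rho k - rho ks.
have gap0 : 0 < gap by rewrite subr_gt0.
have gap40 : 0 < gap / 4 by rewrite divr_gt0.
have small := likely_small (B1 ks).2 gap40 eta30.
have := likelyI (likelyI rate1 rate2) small.
rewrite (_ : eta / 3 + eta / 3 + eta / 3 = eta); last by field.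
apply: filterS3 (near_lt_sqrt 0) (near_lt_sqrt ((`|K1| + `|K2|) / (gap / 4))) => n.
move=> sn0 sn1 [A [mA PA hA]].
exists A; split => // w /hA[[r1 r2] pk] _.
have n0 : (0 < n)%N by rewrite -(ltr_nat R) -sqrtr_gt0; exact: sn0.
have := pen_ge0 k n w n0.
have {}sn0 : 0 < Num.sqrt (n%:R : R) := sn0.
have {}sn1 : _ < Num.sqrt (n%:R : R) := sn1.
set s := Num.sqrt (n%:R : R) in sn0 sn1 r1 r2.
move: r1 r2; rewrite !ler_norml => /andP[_ r1] /andP[r2 _].
have k1 := le_div K1 s (ltW sn0).
have k2 := le_div K2 s (ltW sn0).
have : (`|K1| + `|K2|) / s < gap / 4.
  by rewrite ltr_pdivrMr// mulrC -ltr_pdivrMr.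
rewrite mulrDl; move: pk; rewrite /gap; lra.
Qed.
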